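(* Let $q\in(1,\infty)$ and let $F_1$ be the space of all $f\in C^\infty([0,1])$ for which the norm $\|f\|_q=\left(\sum_{\alpha=0}^\infty\|f^{(\alpha)}\|_{L_q}^q\right)^{1/q}$ is finite. Then integration in the corresponding $d$-fold tensor product space $F_d$ suffers from the curse of dimensionality for positive quadrature formulas.
   Context: $\mathbb{N}=\{1,2,\dots\}$; functions are real-valued and $L_q$-norms are over $[0,1]$. $F_d=F_1\otimes\dots\otimes F_1$ ($d$-fold) is the tensor product space of functions on $[0,1]^d$, equipped with a crossnorm $\|\cdot\|_d$, i.e. $\|f\|_d=\|f_1\|_q\cdots\|f_d\|_q$ for elementary tensors $f(x_1,\dots,x_d)=f_1(x_1)\cdots f_d(x_d)$ with $f_j\in F_1$ (and $\|\cdot\|_d=\|\cdot\|_q$ for $d=1$). Integration: $I_d(f)=\int_{[0,1]^d}f(\boldsymbol{x})\,\mathrm{d}\boldsymbol{x}$. Initial error: $e(0,d)=\sup\{|I_d(f)|: f\in F_d,\ \|f\|_d\le1\}$. For $d=1$ one has $e(0,1)=1$, attained by the constant function $h_1=1$. Standing assumption: for every $d$ the product $h_d(\boldsymbol{x})=\prod_{j=1}^dh_1(x_j)=1$ is a worst-case function in $F_d$, i.e. $e(0,d)=I_d(h_d)/\|h_d\|_d=1$. A positive linear algorithm (positive quadrature formula) is $A_{d,N}^+(f)=\sum_{k=1}^Na_kf(\boldsymbol{x}_k)$ with nodes $\boldsymbol{x}_k\in[0,1]^d$ and weights $a_k\ge0$; its worst-case error is $e(F_d,A_{d,N}^+)=\sup\{|I_d(f)-A_{d,N}^+(f)|: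 f\in F_d,\ \|f\|_d\le1\}$. $e^+(N,d)$ is the infimum of this over all positive linear algorithms using $N$ nodes, and $N^+(\varepsilon,d)=\min\{N\in\mathbb{N}: e^+(N,d)\le\varepsilon\,e(0,d)\}$ ($=\infty$ if no such $N$ exists). Curse of dimensionality for positive quadrature formulas: for some fixed $\varepsilon>0$, $N^+(\varepsilon,d)$ grows at least exponentially fast in $d$, i.e. there are $c>0$, $C>1$ and $d_0\in\mathbb{N}$ with $N^+(\varepsilon,d)\ge c\,C^d$ for all $d\ge d_0$. *)

(* Defs.v *)
From HB Require Import structures.
From mathcomp Require Import all_boot all_order all_algebra.
From mathcomp Require Import all_classical all_reals all_analysis.

Set Implicit Arguments.
Unset Strict Implicit.
Unset Printing Implicit Defensive.

Import Order.TTheory GRing.Theory Num.Theory.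
Import numFieldNormedType.Exports.

Local Open Scope classical_set_scope.
Local Open Scope ring_scope.

Section LebesgueTuple.
Context {R : realType}.

Definition tuple_cons d (p : measurableTypeR R * d.-tuple (measurableTypeR R)) :
  d.+1.-tuple (measurableTypeR R) := [the d.+1.-tuple _ of p.1 :: p.2].

Definition tuple_uncons d (t : d.+1.-tuple (measurableTypeR R)) :
  measurableTypeR R * d.-tuple (measurableTypeR R) :=
  (thead t, [tuple of behead t]).

Lemma measurable_tuple_cons d : measurable_fun setT (@tuple_cons d).
Proof. exact: measurable_cons. Qed.

Lemma measurable_tuple_uncons d : measurable_fun setT (@tuple_uncons d).
Proof.
apply/measurable_fun_pairP; split; last exact: measurable_behead.
exact: (measurable_tnth (ord0 : 'I_d.+1)).
Qed.

Lemma tuple_consK d : cancel (@tuple_cons d) (@tuple_uncons d).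
Proof.
by case=> x t; rewrite /tuple_uncons /tuple_cons theadE; congr pair; exact/val_inj.
Qed.

Section Step.
Variable d : nat.
Variable m : {sigma_finite_measure set (d.-tuple (measurableTypeR R)) -> \bar R}.

Definition lebesgue_tuple_step : set (d.+1.-tuple (measurableTypeR R)) -> \bar R :=
  pushforward (@lebesgue_measure R \x m)%E (@tuple_cons d).

Let step0 : lebesgue_tuple_step set0 = 0%E.
Proof. by rewrite /lebesgue_tuple_step /pushforward preimage_set0 measure0. Qed.

Let step_ge0 A : (0 <= lebesgue_tuple_step A)%E.
Proof. by rewrite /lebesgue_tuple_step /pushforward measure_ge0. Qed.

Let step_sigma_additive : semi_sigma_additive lebesgue_tuple_step.
Proof. by apply: measure_semi_sigma_additive; exact: measurable_tuple_cons. Qed.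

HB.instance Definition _ := isMeasure.Build _ _ _ lebesgue_tuple_step
  step0 step_ge0 step_sigma_additive.

Let step_sigma_finite : sigma_finite setT lebesgue_tuple_step.
Proof.
have /sigma_finiteP[F [FT ndF Foo]] := sigma_finiteT (@lebesgue_measure R).
have /sigma_finiteP[G [GT ndG Goo]] := sigma_finiteT m.
exists (fun n => @tuple_uncons d @^-1` (F n `*` G n)).
  apply/esym; rewrite -preimage_bigcup -subTset => t _ /=.
  have [[i _ Fi] [j _ Gj]] : (\bigcup_n F n) (tuple_uncons t).1 /\
      (\bigcup_n G n) (tuple_uncons t).2 by rewrite -FT -GT.
  exists (maxn i j) => //; split.
    by move: Fi; exact/subsetPset/ndF/leq_maxl.
  by move: Gj; exact/subsetPset/ndG/leq_maxr.
move=> n; have [mF Fn] := Foo n; have [mG Gn] := Goo n; split.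
  rewrite -[X in measurable X]setTI; apply: measurable_tuple_uncons => //.
  exact: measurableX.
rewrite /lebesgue_tuple_step /pushforward -comp_preimage.
rewrite (_ : _ \o _ = id) ?preimage_id; last first.
  by apply/funext => p; exact: tuple_consK.
by rewrite product_measure1E// lte_mul_pinfty// ge0_fin_numE.
Qed.

HB.instance Definition _ :=
  Measure_isSigmaFinite.Build _ _ _ lebesgue_tuple_step step_sigma_finite.

End Step.

(* d-dimensional Lebesgue measure: the d-fold product of lebesgue_measure,
   carried over to d.-tuple (measurableTypeR R). *)
Fixpoint lebesgue_tuple d :
    {sigma_finite_measure set (d.-tuple (measurableTypeR R)) -> \bar R} :=
  match d with
  | 0 => dirac ([tuple] : 0.-tuple (measurableTypeR R))
  | d'.+1 => lebesgue_tuple_step (lebesgue_tuple d')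
  end.

Lemma lebesgue_tuple_box d (A : 'I_d -> set (measurableTypeR R)) :
  (forall i, measurable (A i)) ->
  measurable [set t : d.-tuple (measurableTypeR R) | forall i, A i (tnth t i)] /\
  lebesgue_tuple d [set t | forall i, A i (tnth t i)] =
    (\prod_(i < d) lebesgue_measure (A i))%E.
Proof.
elim: d A => [|d IHd] A mA.
  rewrite (_ : [set _ | _] = setT); last by apply/seteqP; split => // t _ [].
  by rewrite big_ord0 /= diracT; split.
have [mB B] := IHd (fun i => A (lift ord0 i)) (fun i => mA _).
set C := (X in measurable X).
have CE : C = @tuple_uncons d @^-1`
    (A ord0 `*` [set t | forall i, A (lift ord0 i) (tnth t i)]).
  apply/seteqP; split => t /=.
    move=> At; split => [|i] /=; first exact: At.
    by have := At (lift ord0 i); rewrite [t in tnth t _]tuple_eta tnthS.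
  move=> [A0 At] i; case: (unliftP ord0 i) => [j ->|->]; last exact: A0.
  by rewrite [t]tuple_eta tnthS; exact: At.
split.
  rewrite CE -[X in measurable X]setTI; apply: measurable_tuple_uncons => //.
  exact: measurableX.
rewrite /= /lebesgue_tuple_step /pushforward -/C CE -comp_preimage.
rewrite (_ : _ \o _ = id) ?preimage_id; last first.
  by apply/funext => p; exact: tuple_consK.
by rewrite big_ord_recl -B; exact: product_measure1E.
Qed.

End LebesgueTuple.

Section Defs.
Context {R : realType}.
Implicit Types (q : R) (d N : nat).

(* A function on [0,1] (resp. [0,1]^d) is represented by a total function on R
   (resp. d.-tuple R), of which only the values on [0,1] (resp. [0,1]^d) matter. *)

Definition quotient01 (f : R -> R) (x y : R) : R := (f y - f x) / (y - x).

(* Derivative relative to [0,1]: one-sided at the end points. *)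
Definition derivable01 (f : R -> R) (x : R) : Prop :=
  cvg (quotient01 f x @ within `[0, 1] x^').

Definition deriv01 (f : R -> R) (x : R) : R :=
  lim (quotient01 f x @ within `[0, 1] x^').

Definition derivn01 (a : nat) (f : R -> R) : R -> R := iter a deriv01 f.

Definition smooth01 (f : R -> R) : Prop :=
  forall (a : nat) (x : R), x \in `[0, 1] -> derivable01 (derivn01 a f) x.

Definition Lnorm01 q (f : R -> R) : \bar R :=
  Lnorm lebesgue_measure q%:E ((EFin \o f) \_ `[0, 1]).

Definition snorm q (f : R -> R) : \bar R :=
  ((\sum_(0 <= a <oo) Lnorm01 q (derivn01 a f) `^ q) `^ q^-1)%E.

Definition F1 q : set (R -> R) :=
  [set f | smooth01 f /\ (snorm q f < +oo)%E].

Definition cube d : set (d.-tuple R) :=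
  [set t | forall j, tnth t j \in `[0, 1]].
Arguments cube : clear implicits.

Definition tensor d (f : 'I_d -> R -> R) : d.-tuple R -> R :=
  fun t => \prod_(j < d) f j (tnth t j).

(* The d-fold tensor power of F1 as a space of functions on the cube: finite
   sums of elementary tensors (scalars are absorbed in the factors). *)
Definition Fd q d : set (d.-tuple R -> R) :=
  [set f | exists (m : nat) (g : 'I_m -> 'I_d -> R -> R),
     (forall i j, F1 q (g i j)) /\
     (forall t, cube d t -> f t = \sum_(i < m) tensor (g i) t)].
Arguments Fd : clear implicits.

(* A norm on Fd, multiplicative on elementary tensors. By crossnorm_eq0 and the
   triangle inequality, nrm f depends only on the restriction of f to the cube;
   for d = 1, crossnorm_tensor says that nrm is the norm snorm q of F1. *)
Record crossnorm q d (nrm : (d.-tuple R -> R) -> R) : Prop := Crossnorm {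
  crossnorm_ge0 : forall f, Fd q d f -> 0 <= nrm f;
  crossnorm_eq0 : forall f, Fd q d f ->
    (nrm f = 0 <-> forall t, cube d t -> f t = 0);
  crossnormZ : forall (c : R) f, Fd q d f -> nrm (c \*o f) = `|c| * nrm f;
  crossnormD : forall f g, Fd q d f -> Fd q d g -> nrm (f \+ g) <= nrm f + nrm g;
  crossnorm_tensor : forall f : 'I_d -> R -> R, (forall j, F1 q (f j)) ->
    nrm (tensor f) = \prod_(j < d) fine (snorm q (f j))
}.

Definition Int d (f : d.-tuple R -> R) : R :=
  (\int[lebesgue_tuple d]_(t in cube d) f t)%R.

Definition worst_error q d (nrm : (d.-tuple R -> R) -> R)
    (A : (d.-tuple R -> R) -> R) : \bar R :=
  ereal_sup [set `|Int f - A f|%:E | f in [set f | Fd q d f /\ nrm f <= 1]].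

Definition init_error q d (nrm : (d.-tuple R -> R) -> R) : \bar R :=
  ereal_sup [set `|Int f|%:E | f in [set f | Fd q d f /\ nrm f <= 1]].

Definition quadrature d N (a : 'I_N -> R) (x : 'I_N -> d.-tuple R)
    (f : d.-tuple R -> R) : R := \sum_(k < N) a k * f (x k).

Definition pos_min_error q d (nrm : (d.-tuple R -> R) -> R) N : \bar R :=
  ereal_inf [set e | exists (a : 'I_N -> R) (x : 'I_N -> d.-tuple R),
    [/\ forall k, 0 <= a k, forall k, cube d (x k) &
        e = worst_error q nrm (quadrature a x)]].

(* +oo when no number of nodes suffices *)
Definition pos_complexity q d (nrm : (d.-tuple R -> R) -> R) (eps : R) : \bar R :=
  ereal_inf [set N%:R%:E | N in [set N : nat | (0 < N)%N /\
    (pos_min_error q nrm N <= eps%:E * init_error q nrm)%E]].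

Definition h1 : R -> R := cst 1.

Definition hd d : d.-tuple R -> R := tensor (fun _ : 'I_d => h1).
Arguments hd : clear implicits.

Definition hd_worst_case q d (nrm : (d.-tuple R -> R) -> R) : Prop :=
  init_error q nrm = (Int (hd d) / nrm (hd d))%:E /\ init_error q nrm = 1%E.

Definition positive_curse q (nrm : forall d, (d.-tuple R -> R) -> R) : Prop :=
  exists (eps c C : R) (d0 : nat),
    [/\ 0 < eps, 0 < c, 1 < C, (0 < d0)%N &
      forall d, (d0 <= d)%N ->
        ((c * C ^+ d)%:E <= pos_complexity q (nrm d) eps)%E].

End Defs.

(* Main.v *)
Require Import Defs.
From mathcomp Require Import all_boot all_order all_algebra.
From mathcomp Require Import all_classical all_reals all_analysis.
From mathcomp Require Import measurable_realfun ring lra.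

Set Implicit Arguments.
Unset Strict Implicit.
Unset Printing Implicit Defensive.

Import Order.TTheory GRing.Theory Num.Theory.
Import numFieldNormedType.Exports.

Local Open Scope classical_set_scope.
Local Open Scope ring_scope.

(** For x in [0,1] the peak g_x(y) = 1 - s (y - x)^2 is nonnegative, equals 1 at
    x, and for small s has norm at most some rho < 1 independent of x: replacing
    1 by g_x lowers the L_q-norm at first order in s, while the derivatives
    contribute only O(s^q), and q > 1.  If a positive quadrature formula has error
    at most 1/2, testing it on the constant 1 gives weights summing to at least
    1/2, while testing it on rho^-d times the product of the peaks at a node x_k,
    a nonnegative function of norm and integral at most 1, gives
    a_k rho^-d <= 3/2.  Hence N >= rho^-d / 3. *)

(** * One-sided derivatives of polynomials on [0,1] *)

Section Derivatives01.
Context {R : realType}.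
Implicit Types (f : R -> R) (p : {poly R}) (x : R).

(** Properness makes limits along this filter unique, which turns the convergence of difference
    quotients into a value of [deriv01], at the end points too. *)
Lemma within01_dnbhs_proper x : x \in `[0, 1] ->
  ProperFilter (within `[0, 1] (x^' : set_system R)).
Proof.
move=> x01; split; last exact: within_filter.
rewrite /within /= => /nbhs_ballP[e /= e0 H].
move: x01; rewrite in_itv/= => /andP[x0 x1].
(* A point of [0,1] near x and different from x is found by moving towards the far half of the
   interval; a step of at most 1/4 cannot leave [0,1]. *)
have m0 : 0 < Num.min (e / 2) 4^-1 by rewrite lt_min divr_gt0//= invr_gt0.
have [me m4] : Num.min (e / 2) 4^-1 <= e / 2 /\ Num.min (e / 2) 4^-1 <= 4^-1 :> R.
  by rewrite !ge_min !lexx orbT.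
move: me m4 m0; set m := Num.min _ _ => me m4 m0.
have [xh|xh] := leP x 2^-1.
- apply: (H (x + m)) => /=.
  + by rewrite -ball_normE/= opprD addrA subrr sub0r normrN gtr0_norm//; lra.
  + by rewrite -subr_eq0 addrAC subrr add0r gt_eqF.
  + by rewrite in_itv/=; apply/andP; split; lra.
- apply: (H (x - m)) => /=.
  + by rewrite -ball_normE/= opprB addrCA subrr addr0 gtr0_norm//; lra.
  + by rewrite -subr_eq0 addrAC subrr add0r oppr_eq0 gt_eqF.
  + by rewrite in_itv/=; apply/andP; split; lra.
Qed.

(** Writing p - p(x) = r (X - x), the difference quotient at y is r(y), which tends to r(x) = p'(x).
    Agreement of f with p is asked on [0,1] only, because iterated [deriv01] is controlled only
    there and the result has to iterate. *)
Lemma quotient01_horner_cvg f p x : {in `[0, 1], f =1 horner p} ->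
  x \in `[0, 1] -> quotient01 f x @ within `[0, 1] x^' --> (p^`()).[x].
Proof.
move=> fp x01.
have /factor_theorem[r rE] : root (p - p.[x]%:P) x.
  by rewrite /root !hornerE subrr.
have pE y : p.[y] - p.[x] = r.[y] * (y - x).
  by have := congr1 (fun s => s.[y]) rE; rewrite !hornerE.
have -> : p^`() = r^`() * ('X - x%:P) + r.
  have -> : p = p - p.[x]%:P + p.[x]%:P by rewrite subrK.
  by rewrite rE derivD derivM derivXsubC derivC mulr1 addr0.
rewrite !hornerE subrr mulr0 add0r.
have : horner r y @[y --> within `[0, 1] x^'] --> r.[x].
  apply: (@cvg_trans _ (horner r @ x)); last exact: continuous_horner.
  have /(cvg_app (horner r)) : within `[0, 1] x^' --> x by
    apply: (@cvg_trans _ x^'); [exact: cvg_within|exact: nbhs_dnbhs].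
  exact.
apply: cvg_trans; apply: near_eq_cvg; rewrite near_withinE; near=> y => y01.
have yx : y - x != 0 by rewrite subr_eq0; near: y; exact: nbhs_dnbhs_neq.
by rewrite /quotient01 !fp// pE mulfK.
Unshelve. all: by end_near. Qed.

Lemma deriv01_horner f p : {in `[0, 1], f =1 horner p} ->
  {in `[0, 1], deriv01 f =1 horner p^`()}.
Proof.
move=> fp x x01; have := within01_dnbhs_proper x01 => ?.
by apply: cvg_lim => //; exact: quotient01_horner_cvg.
Qed.

Lemma derivn01_horner p a : {in `[0, 1], derivn01 a (horner p) =1 horner p^`(a)}.
Proof.
elim: a => [|a IH]; first by move=> x _; rewrite derivn0.
by rewrite derivnS; exact: deriv01_horner.
Qed.

Lemma smooth01_horner p : smooth01 (horner p).
Proof.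
move=> a x x01; apply/cvg_ex; exists (p^`(a)^`()).[x].
by apply: quotient01_horner_cvg => //; exact: derivn01_horner.
Qed.

End Derivatives01.

(** * Norms of polynomials in F_1 *)

Section PolynomialNorms.
Context {R : realType}.
Implicit Types (f : R -> R) (p : {poly R}) (x q : R).

Local Notation mu := (@lebesgue_measure R).

Lemma integral01_cst (c : R) : (\int[mu]_(x in `[0%R, 1%R]) c%:E = c%:E)%E.
Proof.
rewrite integral_cst; last exact: measurable_itv.
by rewrite /= lebesgue_measure_itv/= lte_fin ltr01 oppr0 adde0 mule1.
Qed.

Lemma integral01_deriv p :
  (\int[mu]_(x in `[0%R, 1%R]) (p^`().[x])%:E = (p.[1] - p.[0])%:E)%E.
Proof.
rewrite EFinB; apply: continuous_FTC2 => //.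
- apply: continuous_subspaceT; exact: continuous_horner.
- split.
  + by move=> x _; exact: derivable_horner.
  + by apply: cvg_at_right_filter; exact: continuous_horner.
  + by apply: cvg_at_left_filter; exact: continuous_horner.
- by move=> x _ /=; rewrite -derivE.
Qed.

Lemma measurable_powR_horner (A : set (measurableTypeR R)) p q :
  measurable_fun A (fun x : measurableTypeR R => `|p.[x : R]| `^ q).
Proof.
apply: (measurableT_comp (measurable_powR q)).
by apply: measurableT_comp => //; exact: measurable_poly.
Qed.

Lemma le_integral01_powR_horner p q (c : R) :
  (forall x, x \in `[0, 1] -> `|p.[x]| `^ q <= c) ->
  (\int[mu]_(x in `[0%R, 1%R]) (`|p.[x]| `^ q)%:E <= c%:E)%E.
Proof.
move=> pc; rewrite -[leRHS]integral01_cst; apply: ge0_le_integral => //.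
by apply/measurable_EFinP; exact: measurable_powR_horner.
Qed.

Lemma poweR_Lnorm01 f p q : q != 0 -> {in `[0, 1], f =1 horner p} ->
  (Lnorm01 q f `^ q = \int[mu]_(x in `[0%R, 1%R]) (`|p.[x]| `^ q)%:E)%E.
Proof.
move=> q0 fp; rewrite /Lnorm01 poweR_Lnorm// [RHS]integral_mkcond.
apply: eq_integral => x _; rewrite /patch; case: ifPn => [|_].
  by rewrite inE/= => x01; rewrite -fp// poweR_EFin.
by rewrite abse0 poweR0r.
Qed.

(** Derivatives of order at least [size p] vanish, so the series defining the norm is a finite
    sum. *)
Lemma snorm_horner p q n : 0 < q -> (size p <= n)%N ->
  snorm q (horner p) =
  ((\sum_(0 <= a < n) \int[mu]_(x in `[0%R, 1%R]) (`|p^`(a).[x]| `^ q)%:E) `^ q^-1)%E.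
Proof.
move=> q0 pn; rewrite /snorm; congr poweR.
have qn0 : q != 0 by rewrite gt_eqF.
under eq_eseriesr => a _.
  rewrite (poweR_Lnorm01 qn0 (derivn01_horner p a)); over.
rewrite (@nneseries_split _ _ 0 n); last first.
  by move=> k _; apply: integral_ge0 => x _; rewrite lee_fin powR_ge0.
rewrite add0n [X in (_ + X)%E]eseries0 ?adde0// => a na _.
under eq_integral => x _.
  rewrite derivn_poly0 ?(leq_trans pn)// horner0 normr0 powR0 ?gt_eqF//; over.
by rewrite integral0.
Qed.

Lemma snorm_horner_le p q (n : nat) (c : nat -> R) : 0 < q -> (size p <= n)%N ->
  (forall a, (a < n)%N ->
    (\int[mu]_(x in `[0%R, 1%R]) (`|p^`(a).[x]| `^ q)%:E <= (c a)%:E)%E) ->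
  (snorm q (horner p) <= ((\sum_(0 <= a < n) c a) `^ q^-1)%:E)%E.
Proof.
move=> q0 pn pc; rewrite (snorm_horner q0 pn) -poweR_EFin.
have I0 a : (0 <= \int[mu]_(x in `[0%R, 1%R]) (`|p^`(a).[x]| `^ q)%:E)%E.
  by apply: integral_ge0 => x _; rewrite lee_fin powR_ge0.
have H : (\sum_(0 <= a < n) \int[mu]_(x in `[0%R, 1%R]) (`|p^`(a).[x]| `^ q)%:E <=
    (\sum_(0 <= a < n) c a)%:E)%E.
  rewrite -sumEFin !big_mkord; apply: lee_sum => i _; exact: pc.
apply: gt0_ler_poweR => //.
- by rewrite invr_ge0 ltW.
- by rewrite in_itv/= leey andbT sume_ge0.
- by rewrite in_itv/= leey andbT; apply: le_trans H; rewrite sume_ge0.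
Qed.

Lemma snorm_ge0 q f : (0 <= snorm q f)%E.
Proof. exact: poweR_ge0. Qed.

(** Each derivative is bounded on the compact interval [0,1], and only finitely many of them
    contribute to the norm. *)
Lemma F1_horner p q : 0 < q -> F1 q (horner p).
Proof.
move=> q0; split; first exact: smooth01_horner.
have B a : exists c : R, forall x, x \in `[0, 1] -> `|p^`(a).[x]| `^ q <= c.
  have := @EVT_max R (fun x => `|p^`(a).[x]|) 0 1 ler01.
  case.
    apply: continuous_subspaceT => x.
    apply: (@continuous_comp _ _ _ (horner p^`(a)) (fun y : R => `|y|)).
      exact: continuous_horner.
    exact: norm_continuous.
  move=> m _ M; exists (`|p^`(a).[m]| `^ q) => x x01.
  by apply: (ge0_ler_powR (ltW q0)); rewrite ?nnegrE//; exact: M.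
have [c Hc] := choice B.
apply: le_lt_trans (ltry _); apply: (snorm_horner_le (c := c) q0 (leqnn _)).
by move=> a _; apply: le_integral01_powR_horner; exact: Hc.
Qed.

Lemma snorm1 q : 0 < q -> snorm q (@h1 R) = 1%E.
Proof.
move=> q0; have -> : @h1 R = horner 1.
  by apply/funext => x; rewrite hornerC.
rewrite (snorm_horner q0 (n := 1)) ?size_poly1// big_nat1 derivn0.
under eq_integral do rewrite hornerC normr1 powR1.
by rewrite integral01_cst poweR1r.
Qed.

End PolynomialNorms.

(** * Peaks of norm uniformly below 1 *)

Section PeakFunctions.
Context {R : realType}.
Implicit Types (x q s : R).

Local Notation mu := (@lebesgue_measure R).

Definition peak s x : {poly R} := 1 - s *: ('X - x%:P) ^+ 2.

Lemma horner_peak s x y : (peak s x).[y] = 1 - s * (y - x) ^+ 2.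
Proof. by rewrite /peak !(hornerE, horner_exp). Qed.

Lemma size_peak s x : (size (peak s x) <= 3)%N.
Proof.
rewrite /peak (leq_trans (size_polyD _ _))// geq_max size_poly1/= size_polyN.
by rewrite (leq_trans (size_scale_leq _ _))// size_exp_XsubC.
Qed.

Lemma horner_deriv_peak s x y : (peak s x)^`(1).[y] = - (s *+ 2 * (y - x)).
Proof.
rewrite derivn1 /peak derivB -polyC1 derivC derivZ expr2 derivM derivXsubC.
by rewrite !hornerE /=; ring.
Qed.

Lemma horner_deriv2_peak s x y : (peak s x)^`(2).[y] = - (s *+ 2).
Proof.
rewrite derivnS derivn1 /peak derivB -polyC1 derivC derivZ expr2 derivM derivXsubC.
by rewrite mul1r mulr1 sub0r derivN derivZ derivD derivXsubC !hornerE /=; ring.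
Qed.

Lemma peak_ge0 s x y : 0 <= s <= 1 -> x \in `[0, 1] -> y \in `[0, 1] ->
  0 <= (peak s x).[y].
Proof.
rewrite !in_itv/= horner_peak => /andP[s0 s1] /andP[x0 x1] /andP[y0 y1].
by rewrite subr_ge0 mulr_ile1 ?sqr_ge0//; nra.
Qed.

(* The peak takes values in [0, 1], so its q-th power is at most the peak itself,
   which is the derivative of an explicit cubic. *)
Lemma integral01_peak_le q s x : 1 <= q -> 0 <= s <= 1 -> x \in `[0, 1] ->
  (\int[mu]_(y in `[0%R, 1%R]) (`|(peak s x).[y]| `^ q)%:E <= (1 - s / 12)%:E)%E.
Proof.
move=> q1 s01 x01.
pose P : {poly R} := 'X - (s / 3) *: ('X - x%:P) ^+ 3.
have dP : P^`() = peak s x.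
  rewrite /P derivB derivZ derivX deriv_exp derivXsubC mul1r /=.
  by rewrite -(scaler_nat 3 (_ ^+ 2)) scalerA /peak divfK.
apply: (@le_trans _ _ (\int[mu]_(y in `[0%R, 1%R]) (P^`().[y])%:E)%E).
  apply: ge0_le_integral => //.
  - by apply/measurable_EFinP; exact: measurable_powR_horner.
  - by apply/measurable_EFinP; exact: measurable_poly.
  - move=> y /= y01; rewrite lee_fin dP.
    have p0 := peak_ge0 s01 x01 y01; rewrite ger0_norm//.
    have [->|pn0] := eqVneq (peak s x).[y] 0.
      by rewrite powR0// gt_eqF// (lt_le_trans ltr01).
    apply: ge1r_powR => //; rewrite lt_neqAle eq_sym pn0 p0/= horner_peak.
    by rewrite gerBl mulr_ge0 ?sqr_ge0//; case/andP: s01.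
rewrite integral01_deriv lee_fin /P !(hornerE, horner_exp)/=.
(* The integral of the peak is 1 - s ((1 - x)^3 + x^3) / 3 = 1 - s ((x - 1/2)^2 + 1/12), so the
   worst case is x = 1/2. *)
have := mulr_ge0 (proj1 (andP s01)) (sqr_ge0 (x - 2^-1)).
by rewrite /=; lra.
Qed.

(** The choice of s solves s^(q-1) = 1/96, which is possible because q > 1; this is what makes the
    derivatives of the peak negligible against its first-order gain. *)
Lemma exists_le1_powR_small q : 1 < q ->
  exists s : R, [/\ 0 < s, s <= 1 & s `^ q <= s / 96].
Proof.
move=> q1; have q0 : 0 < q - 1 by rewrite subr_gt0.
pose s : R := 96^-1 `^ (q - 1)^-1.
have s0 : 0 < s by rewrite powR_gt0.
exists s; split => //.
  rewrite -[leRHS](_ : 1 `^ (q - 1)^-1 = 1); last by rewrite powR1.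
  by apply: ge0_ler_powR; rewrite ?nnegrE ?invr_ge0 ?ltW//; lra.
rewrite -(mulr_powRB1 (ltW s0)) ?(lt_trans ltr01)//.
by rewrite -powRrM mulVf ?gt_eqF// powRr1.
Qed.

Lemma exists_peak q : 1 < q -> exists rho : R, 0 < rho < 1 /\
  forall x, x \in `[0, 1] -> exists p : {poly R},
    [/\ p.[x] = 1, forall y, y \in `[0, 1] -> 0 <= p.[y] &
        (snorm q (horner p) <= rho%:E)%E].
Proof.
move=> q1; have q0 : 0 < q by exact: lt_trans q1.
have [s [s0 s1 sq]] := exists_le1_powR_small q1.
(* For the peak with parameter s/2, the function itself contributes at most 1 - s/24 to the q-th
   power of the norm. Its first and second derivatives are at most s in absolute value and
   contribute at most s/96 each, which leaves 1 - s/24 + 2 s/96 = 1 - s/48. *)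
exists ((1 - s / 48) `^ q^-1); split.
  rewrite powR_gt0/=; last lra.
  rewrite -[ltRHS](_ : 1 `^ q^-1 = 1); last by rewrite powR1.
  by apply: gt0_ltr_powR; rewrite ?nnegrE ?invr_gt0//; lra.
move=> x x01; exists (peak (s / 2) x).
have s01 : 0 <= s / 2 <= 1 by apply/andP; split; lra.
split; [by rewrite horner_peak subrr expr0n/= mulr0 subr0| |].
  by move=> y y01; exact: peak_ge0.
have -> : 1 - s / 48 = \sum_(0 <= a < 3) (if a == 0 then 1 - s / 24 else s / 96).
  by rewrite !big_nat_recr//= big_nil; field.
apply: snorm_horner_le => //; first exact: size_peak.
have s2 : s / 2 *+ 2 = s by rewrite -mulr_natr divfK.
have sq' (t : R) : `|t| <= s -> `|t| `^ q <= s / 96.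
  by move=> ts; apply: le_trans sq; apply: (ge0_ler_powR (ltW q0)); rewrite ?nnegrE// ltW.
move=> [|[|[|//]]] _ /=.
- have -> : 1 - s / 24 = 1 - s / 2 / 12 by field.
  by apply: integral01_peak_le => //; exact: ltW.
- apply: le_integral01_powR_horner => y y01; apply: sq'.
  rewrite horner_deriv_peak; move: x01 y01; rewrite !in_itv/= => /andP[x0 x1] /andP[y0 y1].
  rewrite normrN s2 normrM gtr0_norm// ler_piMr ?(ltW s0)//.
  by rewrite ler_norml; apply/andP; split; lra.
- apply: le_integral01_powR_horner => y y01; apply: sq'.
  by rewrite horner_deriv2_peak normrN s2 gtr0_norm.
Qed.

End PeakFunctions.

(** * Lower bound on the number of nodes *)

Section Complexity.
Context {R : realType}.
Implicit Types (q rho : R) (d N : nat).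

Lemma Fd_tensor q d (f : 'I_d -> R -> R) : (forall j, F1 q (f j)) ->
  Fd q (tensor f).
Proof.
by move=> Ff; exists 1%N, (fun _ => f); split=> // t _; rewrite big_ord1.
Qed.

Lemma worst_error_ge q d (nrm : (d.-tuple R -> R) -> R) A f :
  Fd q f -> nrm f <= 1 -> (`|Int f - A f|%:E <= worst_error q nrm A)%E.
Proof. by move=> Ff f1; apply: ereal_sup_ubound; exists f. Qed.

Lemma init_error_ge q d (nrm : (d.-tuple R -> R) -> R) f :
  Fd q f -> nrm f <= 1 -> (`|Int f|%:E <= init_error q nrm)%E.
Proof. by move=> Ff f1; apply: ereal_sup_ubound; exists f. Qed.

Lemma quadrature_size_ge q rho d (nrm : (d.-tuple R -> R) -> R) N
    (a : 'I_N -> R) (x : 'I_N -> d.-tuple R) :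
  0 < q -> 0 < rho ->
  (forall y, y \in `[0, 1] -> exists p : {poly R},
    [/\ p.[y] = 1, forall z, z \in `[0, 1] -> 0 <= p.[z] &
        (snorm q (horner p) <= rho%:E)%E]) ->
  crossnorm q nrm -> hd_worst_case q nrm ->
  (forall k, 0 <= a k) -> (forall k, cube (x k)) ->
  (worst_error q nrm (quadrature a x) <= 2^-1%:E)%E ->
  3^-1 * rho^-1 ^+ d <= N%:R.
Proof.
move=> q0 rho0 peakP cn [Inthd init1] a0 xc err.
have err_le f : Fd q f -> nrm f <= 1 -> `|Int f - quadrature a x f| <= 2^-1.
  by move=> Ff f1; rewrite -lee_fin; apply: le_trans err; exact: worst_error_ge.
have sum_a : 2^-1 <= \sum_(k < N) a k.
  have Fh1 : F1 q (@h1 R).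
    by have := F1_horner 1 q0; congr F1; apply/funext => y; rewrite hornerC.
  have nh : nrm (@hd R d) = 1.
    rewrite (crossnorm_tensor cn)// big1// => j _.
    by rewrite snorm1.
  (* The integral is not computed: it is read off from the worst-case assumption, as the norm of
     [hd] is 1. *)
  have Ih : Int (@hd R d) = 1.
    by move: Inthd; rewrite init1 nh divr1 => -[].
  have := @err_le (@hd R d) (Fd_tensor (fun _ => Fh1)).
  rewrite nh lexx => /(_ isT); rewrite Ih /quadrature.
  under eq_bigr do rewrite /hd /tensor big1// mulr1.
  by rewrite ler_norml => /andP[_]; lra.
have a_le k : a k * rho^-1 ^+ d <= 3 / 2.
  have /choice[p pP] : forall j, exists p : {poly R},
      [/\ p.[tnth (x k) j] = 1, forall z, z \in `[0, 1] -> 0 <= p.[z] &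
          (snorm q (horner p) <= rho%:E)%E].
    by move=> j; apply: peakP; exact: xc.
  pose g := tensor (fun j => horner (p j)).
  (* Each factor of [g] has norm at most rho, so by the crossnorm property the rescaled product [f]
     lies in the unit ball, while its value at the node is rho^-d. *)
  pose f := tensor (fun j => horner (rho^-1 *: p j)).
  have fE : f = (rho^-1 ^+ d) \*o g.
    apply/funext => t; rewrite /f /g /tensor/=.
    under eq_bigr do rewrite hornerZ.
    by rewrite big_split/= prodr_const card_ord.
  have Fg : Fd q g by apply: Fd_tensor => j; exact: F1_horner.
  have Ff : Fd q f by apply: Fd_tensor => j; exact: F1_horner.
  have f1 : nrm f <= 1.
    rewrite fE (crossnormZ cn)// ger0_norm ?exprn_ge0 ?invr_ge0 ?(ltW rho0)//.
    rewrite exprVn ler_pdivrMl ?exprn_gt0// mulr1.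
    rewrite (crossnorm_tensor cn); last by move=> j; exact: F1_horner.
    rewrite -[in leRHS](card_ord d) -prodr_const; apply: ler_prod => j _.
    have [_ _ nj] := pP j; rewrite fine_ge0 ?snorm_ge0//=.
    rewrite -lee_fin fineK// ge0_fin_numE ?snorm_ge0//.
    exact: le_lt_trans nj (ltry _).
  have fge0 i : 0 <= f (x i).
    apply: prodr_ge0 => j _; rewrite hornerZ mulr_ge0// ?invr_ge0 ?(ltW rho0)//.
    by have [_ + _] := pP j; apply; exact: xc.
  have fxk : f (x k) = rho^-1 ^+ d.
    rewrite fE/= /g /tensor big1 ?mulr1// => j _; by have [] := pP j.
  have : a k * f (x k) <= quadrature a x f.
    by rewrite /quadrature (bigD1 k)//= lerDl sumr_ge0// => i _; rewrite mulr_ge0.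
  (* The initial error being 1 bounds the integral over the unit ball; adding the quadrature error
     1/2 gives the constant 3/2. *)
  have : `|Int f| <= 1.
    by have := init_error_ge Ff f1; rewrite init1 lee_fin.
  have := err_le _ Ff f1.
  rewrite fxk !ler_norml => /andP[? ?] /andP[? ?]; lra.
(* Summed over the nodes, the bounds on single weights meet the lower bound 1/2 on the total weight:
   rho^-d / 2 <= 3 N / 2. *)
have : (\sum_(k < N) a k) * rho^-1 ^+ d <= N%:R * (3 / 2).
  rewrite mulr_suml mulr_natl -[in leRHS](card_ord N) -sumr_const.
  exact: ler_sum.
have := @ler_wpM2r _ (rho^-1 ^+ d) _ _ _ sum_a.
rewrite exprn_ge0 ?invr_ge0 ?(ltW rho0)// => /(_ isT); lra.
Qed.

End Complexity.

Theorem mainTheorem11 (R : realType) (q : R)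
    (nrm : forall d : nat, (d.-tuple R -> R) -> R) :
  1 < q ->
  (forall d : nat, (0 < d)%N -> crossnorm q (nrm d)) ->
  (forall d : nat, (0 < d)%N -> hd_worst_case q (nrm d)) ->
  positive_curse q nrm.
Proof.
move=> q1 cn wc; have q0 : 0 < q by exact: lt_trans q1.
have [rho [/andP[rho0 rho1] peakP]] := exists_peak q1.
(* The minimal error is an infimum that need not be attained. Taking epsilon = 1/4, strictly below
   1/2, yields an actual quadrature formula with error below 1/2. *)
exists 4^-1, 3^-1, rho^-1, 1%N; split => //; rewrite ?invr_gt0 ?invf_gt1//.
move=> d d0; apply: le_ereal_inf_tmp => _ [N [_ +] <-].
have [_ ->] := wc d d0; rewrite mule1 => errN.
have /ereal_inf_lt[_ [a [x [a0 xc ->]]] err] :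
    (pos_min_error q (nrm d) N < 2^-1%:E)%E.
  by apply: le_lt_trans errN _; rewrite lte_fin; lra.
by rewrite lee_fin; apply: (quadrature_size_ge q0 rho0 peakP (cn d d0)
  (wc d d0) a0 xc (ltW err)).
Qed.
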